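(* Let $g>0$, $h>0$ and $k>0$ be real numbers. Let $\rho_0\in C^1([-h,0])$ be strictly increasing with $0<\rho_-=\rho_0(-h)<\rho_0(0)=\rho_+<+\infty$, and set $L_0:=\Big(\max_{[-h,0]}\frac{\rho_0'}{\rho_0}\Big)^{-1}$. Then there exists an infinite sequence $(\lambda_j,\phi_j)_{j\ge 1}$ with $\lambda_j\in\big(0,\sqrt{g/L_0}\big)$ and $\phi_j\in H^2(-h,0)$, $\phi_j\not\equiv 0$, such that for every $j\ge 1$ $$\lambda_j^2\big(k^2\rho_0\phi_j-(\rho_0\phi_j')'\big)=gk^2\rho_0'\phi_j\quad\text{in }(-h,0),$$ $$\lambda_j^2\rho_+\phi_j'(0)+gk^2\rho_+\phi_j(0)=0,\qquad \phi_j(-h)=0.$$ Furthermore, the sequence $(\lambda_j)_{j\ge1}$ is decreasing and converges to $0$ as $j\to\infty$.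
   Context: Functions are real-valued. $H^2(-h,0)$ is the usual Sobolev space on the interval $(-h,0)$; the values $\phi(-h)$, $\phi(0)$, $\phi'(0)$ are taken for the continuous representatives. A prime denotes the derivative in the variable $x\in(-h,0)$. *)

(* Defs.v *)
From HB Require Import structures.
From mathcomp Require Import all_boot all_order all_algebra.
From mathcomp Require Import all_classical all_reals all_analysis.

Set Implicit Arguments.
Unset Strict Implicit.
Unset Printing Implicit Defensive.

Import Order.TTheory GRing.Theory Num.Theory.
Import numFieldNormedType.Exports.

Local Open Scope classical_set_scope.
Local Open Scope ring_scope.

(* Derivative of f relative to the set D: one-sided at the end points when D is
   a closed interval.  Meaningful only when the limit exists, cf. C1_on. *)
Definition derive_within {R : realType} (D : set R) (f : R -> R) (x : R) : R :=
  lim ((f y - f x) / (y - x) @[y --> within D x^']).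

(* f \in C^1([a, b]); the values of f outside [a, b] are irrelevant. *)
Definition C1_on {R : realType} (a b : R) (f : R -> R) : Prop :=
  (forall x, x \in `[a, b] ->
     cvg ((f y - f x) / (y - x) @[y --> within `[a, b] x^'])) /\
  {within `[a, b], continuous (derive_within `[a, b] f)}.

(* C^oo functions whose support is a compact subset of the open set A. *)
Definition test_function {R : realType} (A : set R) (psi : R -> R) : Prop :=
  [/\ forall n x, derivable (derive1n n psi) x 1,
      compact (closure [set x | psi x != 0]) &
      closure [set x | psi x != 0] `<=` A].

(* v is the derivative of u in the sense of distributions on the open set A. *)
Definition weak_derivative {R : realType} (A : set R) (u v : R -> R) : Prop :=
  [/\ locally_integrable A u, locally_integrable A v &
      forall psi, test_function A psi ->
        \int[lebesgue_measure]_(x in A) (u x * derive1 psi x) =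
        - \int[lebesgue_measure]_(x in A) (v x * psi x)].

(* u \in L^2(A), via the extension by zero u \_ A. *)
Definition L2 {R : realType} (A : set R) (u : R -> R) : Prop :=
  u \_ A \in Lfun lebesgue_measure 2%:E.

(* Elements of H^2(A) are given by arbitrary representatives R -> R. *)
Definition H2 {R : realType} (A : set R) (u : R -> R) : Prop :=
  exists u1 u2, [/\ weak_derivative A u u1, weak_derivative A u1 u2,
                    L2 A u, L2 A u1 & L2 A u2].

Definition continuous_representative {R : realType} (a b : R) (u c : R -> R) :
    Prop :=
  {within `[a, b], continuous c} /\
  u = c %[ae lebesgue_measure in `]a, b[%classic].

(* The maximum is the supremum, being attained for rho0 positive and C^1. *)
Definition density_length {R : realType} (h : R) (rho0 : R -> R) : R :=
  (sup [set derive_within `[- h, 0] rho0 x / rho0 x | x in `[- h, 0]])^-1.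

(* dphi is phi' and dflux is (rho0 phi')'; weak derivatives being unique up to
   null sets and continuous representatives unique on [-h, 0], the existential
   quantifiers do not depend on choices. *)
Definition solves_eigenproblem {R : realType} (g h k : R) (rho0 : R -> R)
    (lambda : R) (phi : R -> R) : Prop :=
  exists dphi dflux phic dphic : R -> R,
    [/\ weak_derivative `]- h, 0[ phi dphi,
        weak_derivative `]- h, 0[ (fun x => rho0 x * dphi x) dflux,
        \forall x \ae lebesgue_measure, x \in `]- h, 0[ ->
          lambda ^+ 2 * (k ^+ 2 * rho0 x * phi x - dflux x) =
          g * k ^+ 2 * derive_within `[- h, 0] rho0 x * phi x,
        continuous_representative (- h) 0 phi phic /\
        continuous_representative (- h) 0 dphi dphic &
        lambda ^+ 2 * rho0 0 * dphic 0 + g * k ^+ 2 * rho0 0 * phic 0 = 0 /\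
        phic (- h) = 0].

(* Main.v *)
Require Import Defs.
From mathcomp Require Import all_boot all_order all_algebra.
From mathcomp Require Import all_classical all_reals all_analysis.
From mathcomp Require Import measurable_realfun ring lra.
Import Order.TTheory GRing.Theory Num.Theory.
Import numFieldNormedType.Exports.
Local Open Scope classical_set_scope.
Local Open Scope ring_scope.

Set Implicit Arguments.
Unset Strict Implicit.
Unset Printing Implicit Defensive.

(** With [mu = lambda^-2], the equation is the Sturm-Liouville equation
    [(rho0 phi')' = - (mu w - z) phi] with [w = g k^2 rho0'] and
    [z = k^2 rho0], and the condition at [0] reads
    [phi'(0) = - mu g k^2 phi(0)]: the eigenparameter also occurs in the
    boundary condition.  This makes the phase-plane method of Pruefer more
    convenient than a variational one.  Writing [phi = r sin th] and
    [rho0 phi' = r cos th] turns the equation into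
      [th' = rho0^-1 cos^2 th + (mu w - z) sin^2 th],
      [r'  = r (rho0^-1 - (mu w - z)) sin th cos th].
    The first equation does not involve [r] and is globally Lipschitz in [th],
    so it has a solution [th mu] vanishing at [- h] ([picard],
    [prufer_angle_exists]); the second one is then solved by an exponential.
    The condition at [- h] holds by construction, and the one at [0] holds as
    soon as
      [G mu := th mu 0 - pi / 2 - atan (mu g k^2 rho0(0))]
    is [n pi] for some natural number [n] ([prufer_phase_eigenfunction]).

    [G] is continuous by Gronwall's inequality ([prufer_angle_continuous]).  It
    tends to [+oo] with [mu]: [rho0'] is bounded below by a positive constant on
    some subinterval, where the angle turns at an average speed of order
    [sqrt mu] ([prufer_angle_stretch]), and the angle decreases at a bounded
    speed elsewhere, because [rho0' >= 0] ([prufer_angle_lower_bound]).  Hence,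
    by the intermediate value theorem, [G] takes values in [pi nat] at
    arbitrarily large [mu] ([large_eigenparameter]).  A sequence of such [mu]
    with successive gaps at least [1], starting above [L0 / g], yields the
    eigenvalues [lambda = mu ^ (- 1 / 2)]: they are less than [sqrt (g / L0)],
    decrease and tend to [0].

    The eigenfunctions are classically differentiable, and the weak formulation
    follows by integration by parts ([is_derive_weak_derivative]). *)

(** * Restriction to a segment and functions of class C^1 *)

Section Clamp.
Context {R : realType}.
Implicit Types (a b x : R) (f : R -> R).

(** Precomposition with this retraction of the line onto [[a, b]] extends a
    continuous function on [[a, b]] to the whole line; the coefficients of the
    differential equation thereby become bounded continuous functions on the
    line. *)
Definition clamp a b x : R := Num.max a (Num.min x b).

Lemma clamp_itv a b x : a <= b -> clamp a b x \in `[a, b].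
Proof.
move=> ab; rewrite /clamp in_itv/= le_max lexx/= ge_max ab/=.
by rewrite ge_min lexx orbT.
Qed.

Lemma clamp_id a b x : x \in `[a, b] -> clamp a b x = x.
Proof.
by rewrite in_itv/= => /andP[ax xb]; rewrite /clamp min_l// max_r.
Qed.

Lemma continuous_clamp a b : continuous (clamp a b).
Proof.
apply: max_fun_continuous => x; first exact: cvg_cst.
by apply: (@min_fun_continuous _ _ R id (cst b)) => y; [exact: cvg_id|exact: cvg_cst].
Qed.

Lemma continuous_comp_clamp a b f : a <= b ->
  {within `[a, b], continuous f} -> continuous (f \o clamp a b).
Proof.
move=> ab cf x; apply/cvgrPdist_lt => e e0.
have xab := clamp_itv x ab.
move/subspace_continuousP : cf => /(_ (clamp a b x)).
move=> /(_ xab) /cvgrPdist_lt /(_ e e0).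
rewrite !near_simpl near_withinE => /(@continuous_clamp a b x); rewrite near_simpl.
by move=> h; near=> y => /=; have := clamp_itv y ab; near: y.
Unshelve. all: by end_near. Qed.

End Clamp.

Section C1.
Context {R : realType}.
Implicit Types (a b x : R) (f : R -> R).

(** Caratheodory's form of differentiability, relative to the segment: it serves
    both the two-sided derivative at interior points and the continuity up to
    the end points. *)
Lemma C1_on_slope a b f x : C1_on a b f -> x \in `[a, b] ->
  exists g : R -> R, [/\ forall z, f z - f x = g z * (z - x),
    g z @[z --> within `[a, b] (nbhs x)] --> g x &
    g x = derive_within `[a, b] f x].
Proof.
move=> [cf _] xab.
have fl := cf _ xab; rewrite -/(derive_within `[a, b] f x) in fl.
set l := derive_within _ _ _ in fl *.
exists (fun z => if z == x then l else (f z - f x) / (z - x)).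
rewrite eqxx; split => //.
  move=> z; case: eqP => [->|/eqP]; first by rewrite !subrr mulr0.
  by rewrite -subr_eq0 => /divfK->.
apply/cvgrPdist_lt => e e0.
move/cvgrPdist_lt : fl => /(_ e e0).
rewrite !near_withinE => h.
apply: filterS h => z h zab.
case: eqP => [_|/eqP zx]; first by rewrite subrr normr0.
exact: h.
Qed.

Lemma C1_on_is_derive a b f x : C1_on a b f -> x \in `]a, b[ ->
  is_derive x 1 f (derive_within `[a, b] f x).
Proof.
move=> cf xab.
have xab' : x \in `[a, b] by apply: subset_itv_oo_cc.
have [g [fg cg gx]] := C1_on_slope cf xab'.
apply/is_derive1_caratheodory; exists g; split => //.
rewrite within_interior// in cg.
apply: filterS (near_in_itvoo xab) => y; exact: subset_itv_oo_cc.
Qed.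

Lemma C1_on_continuous a b f : C1_on a b f -> {within `[a, b], continuous f}.
Proof.
move=> cf; apply/subspace_continuousP => x xab.
have [g [fg cg gx]] := C1_on_slope cf xab.
have : f x + g z * (z - x) @[z --> within `[a, b] (nbhs x)] -->
    f x + g x * (x - x).
  apply: cvgD; first exact: cvg_cst.
  apply: cvgM => //; apply: cvgB; last exact: cvg_cst.
  exact: cvg_within.
rewrite subrr mulr0 addr0; under eq_fun do rewrite -fg subrKC.
exact.
Qed.

End C1.

Section C1_increasing.
Context {R : realType}.
Variables (a b : R) (f : R -> R).
Hypotheses (ab : a < b) (f_C1 : C1_on a b f).
Hypothesis f_incr : forall x y, x \in `[a, b] -> y \in `[a, b] ->
  x < y -> f x < f y.

Lemma C1_increasing_derive_ge0 x : x \in `]a, b[ ->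
  0 <= derive_within `[a, b] f x.
Proof.
move=> xab.
have [dfx dfE] := C1_on_is_derive f_C1 xab.
rewrite -dfE -derive1E; apply: (@incr_derive1_ge0_itv _ f true false a b) => //.
- by move=> z /[!inE] zab; have [] := C1_on_is_derive f_C1 zab.
Qed.

(** Strict monotonicity allows the derivative to vanish, even on a large set, but
    not everywhere: the mean value theorem gives one good point. *)
Lemma C1_increasing_derive_gt0 :
  exists2 c, c \in `]a, b[ & 0 < derive_within `[a, b] f c.
Proof.
have [c cab fE] := MVT ab (fun x => @C1_on_is_derive _ a b f x f_C1)
  (C1_on_continuous f_C1).
exists c => //; rewrite -(@pmulr_lgt0 _ (b - a)) ?subr_gt0// -fE subr_gt0.
by apply: f_incr => //; rewrite in_itv/= lexx ltW.
Qed.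

End C1_increasing.

(** * Comparison of functions through their derivatives *)

Section Comparison.
Context {R : realType}.
Implicit Types (a b x : R) (u v du dv : R -> R).

Lemma is_derive_continuous u x (du : R) : is_derive x 1 u du -> {for x, continuous u}.
Proof. by move=> [+ _] => /derivable1_diffP/differentiable_continuous. Qed.

Lemma is_derive_within_continuous a b u du :
  (forall x, x \in `[a, b] -> is_derive x 1 u (du x)) ->
  {within `[a, b], continuous u}.
Proof.
move=> ud; apply: continuous_in_subspaceT => x.
by rewrite inE => /ud/is_derive_continuous.
Qed.

Lemma derive_ge0_le a b u du : a <= b ->
  (forall x, x \in `[a, b] -> is_derive x 1 u (du x)) ->
  (forall x, x \in `]a, b[ -> 0 <= du x) -> u a <= u b.
Proof.
rewrite le_eqVlt => /predU1P[-> //|ab] ud du0.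
have ud' x : x \in `]a, b[ -> is_derive x 1 u (du x).
  by move=> /subset_itv_oo_cc; exact: ud.
have [c cab uE] := MVT ab ud' (is_derive_within_continuous ud).
by rewrite -subr_ge0 uE mulr_ge0 ?du0// subr_ge0 ltW.
Qed.

(** The bounds are stated as two inequalities rather than as a bound on a norm
    because both [v - u] and [v + u] are nondecreasing: each side is an instance
    of [derive_ge0_le]. *)
Lemma derive_dominated a b u v du dv : a <= b ->
  (forall x, x \in `[a, b] -> is_derive x 1 u (du x)) ->
  (forall x, x \in `[a, b] -> is_derive x 1 v (dv x)) ->
  (forall x, x \in `[a, b] -> - dv x <= du x <= dv x) ->
  - v a <= u a <= v a -> - v b <= u b <= v b.
Proof.
move=> ab ud vd duv /andP[ua1 ua2]; apply/andP; split.
- suff: u a + v a <= u b + v b by lra.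
  apply: (@derive_ge0_le _ _ (u \+ v) (du \+ dv)) => // x xab.
    by apply: is_deriveD; [exact: ud|exact: vd].
  by have /andP[] := duv x (subset_itv_oo_cc xab); rewrite /=; lra.
- suff: v a - u a <= v b - u b by lra.
  apply: (@derive_ge0_le _ _ (v \- u) (dv \- du)) => // x xab.
    by apply: is_deriveB; [exact: vd|exact: ud].
  by have /andP[] := duv x (subset_itv_oo_cc xab); rewrite /=; lra.
Qed.

(** Squaring removes the absolute values: [(u ^ 2)' = 2 u u' <= K u ^ 2 + e ^ 2]
    with [K = 2 M + 1], since [2 e |u| <= u ^ 2 + e ^ 2], so that
    [e ^ 2 x - u ^ 2 exp (- K (x - a))] is nondecreasing. The constant is not
    sharp; what matters is that the bound is linear in [e]. *)
Lemma gronwall a b u du M e : a <= b -> 0 <= M -> 0 <= e ->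
  (forall x, x \in `[a, b] -> is_derive x 1 u (du x)) ->
  (forall x, x \in `[a, b] -> `|du x| <= M * `|u x| + e) ->
  u a = 0 -> `|u b| <= e * ((b - a + 1) * expR ((M *+ 2 + 1) * (b - a))).
Proof.
move=> ab M0 e0 ud duM ua.
pose K := M *+ 2 + 1.
pose E := fun x => expR (- K * (x - a)).
have Ed x : is_derive x 1 E (- K * E x).
  rewrite /E; by apply: is_derive_eq; rewrite /GRing.scale/=; ring.
have EK x : E x * expR (K * (x - a)) = 1.
  by rewrite /E mulNr expRN mulVf ?gt_eqF ?expR_gt0.
have K_ge0 : 0 <= K by rewrite /K; lra.
have w : e ^+ 2 * a - u a ^+ 2 * E a <= e ^+ 2 * b - u b ^+ 2 * E b.
  apply: (@derive_ge0_le _ _ (fun x => e ^+ 2 * x - u x ^+ 2 * E x)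
   (fun x => e ^+ 2  - (u x * du x *+ 2 - K * u x ^+ 2) * E x)) => // x xab.
    have := ud _ xab => udx.
    by apply: is_derive_eq; rewrite /GRing.scale/=; ring.
  have E1 : E x <= 1.
    rewrite /E expR_le1 mulNr oppr_le0 mulr_ge0// subr_ge0.
    by move: xab; rewrite in_itv/= => /andP[/ltW].
  have E0 : 0 < E x by exact: expR_gt0.
  have := duM _ (subset_itv_oo_cc xab).
  have uN : u x ^+ 2 = `|u x| ^+ 2 by rewrite real_normK ?num_real.
  have udN : u x * du x <= `|u x| * `|du x|.
    by rewrite -normrM ler_norm.
  have u0 := normr_ge0 (u x); rewrite /K uN.
  move: `|u x| `|du x| u0 udN => N D N0 udN DM.
  have DM' : N * D <= N * (M * N + e) by rewrite ler_wpM2l.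
  have sq := sqr_ge0 (N - e).
  suff X : u x * du x *+ 2 - (M *+ 2 + 1) * N ^+ 2 <= e ^+ 2.
    have : (u x * du x *+ 2 - (M *+ 2 + 1) * N ^+ 2) * E x <= e ^+ 2 * E x.
      by rewrite ler_wpM2r// ltW.
    have : e ^+ 2 * E x <= e ^+ 2 by rewrite ler_piMr// sqr_ge0.
    lra.
  nra.
have F1 : 1 <= expR (K * (b - a)) by rewrite -expR0 ler_expR mulr_ge0// subr_ge0.
rewrite -/K; move: (expR _) F1 (EK b) => F F1 EF.
have Y0 : 0 <= e * ((b - a + 1) * F).
  by apply: mulr_ge0 => //; apply: mulr_ge0; lra.
rewrite -(@ler_pXn2r _ 2)// ?nnegrE// real_normK ?num_real//.
have -> : u b ^+ 2 = u b ^+ 2 * E b * F by rewrite -mulrA EF mulr1.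
have : u b ^+ 2 * E b <= e ^+ 2 * (b - a).
  by move: w; rewrite ua; lra.
move=> /(ler_wpM2r (le_trans ler01 F1)) /le_trans; apply.
rewrite !exprMn -mulrA ler_wpM2l ?sqr_ge0//.
have d0 : 0 <= b - a by rewrite subr_ge0.
move: (b - a) d0 => d d0.
have FF : F <= F ^+ 2 by rewrite expr2 ler_peMr//; lra.
have dd : d <= (d + 1) ^+ 2 by nra.
by apply: ler_pM => //; lra.
Qed.

End Comparison.

(** * Existence for a globally Lipschitz differential equation *)

Section Picard.
Context {R : realType}.
Implicit Types (a b x : R).

Lemma exists_half_pow_lt (D e : R) : 0 <= D -> 0 < e ->
  exists n, D / 2 ^+ n < e.
Proof.
move=> D0 e0; exists (Num.bound (D / e)).
have De0 : 0 <= D / e by rewrite divr_ge0// ltW.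
rewrite ltr_pdivrMr ?exprn_gt0// mulrC -ltr_pdivrMr//.
apply: lt_le_trans (archi_boundP De0) _.
by rewrite -natrX ler_nat ltnW// ltn_expl.
Qed.

(** The sequences [u n -+ 2 D / 2 ^ n] are adjacent; the limit is the supremum of
    the lower one. *)
Lemma dyadic_cauchy_limit (u : nat -> R) (D : R) : 0 <= D ->
  (forall n, `|u n.+1 - u n| <= D / 2 ^+ n) ->
  exists l, forall n, `|u n - l| <= D * 2 / 2 ^+ n.
Proof.
move=> D0 uD.
pose lo n : R := u n - D * 2 / 2 ^+ n; pose hi n : R := u n + D * 2 / 2 ^+ n.
have half n : D * 2 / 2 ^+ n.+1 = D / 2 ^+ n.
  by rewrite exprS; field; rewrite expf_neq0.
have half2 n : D * 2 / 2 ^+ n = D / 2 ^+ n + D / 2 ^+ n.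
  by field; rewrite expf_neq0.
have lo_nd : {homo lo : n m / (n <= m)%N >-> n <= m}.
  apply/nondecreasing_seqP => n; rewrite /lo half half2.
  by have := uD n; rewrite ler_norml; lra.
have hi_ni : {homo hi : n m / (n <= m)%N >-> m <= n}.
  apply/nonincreasing_seqP => n; rewrite /hi half half2.
  by have := uD n; rewrite ler_norml; lra.
have lohi n m : lo n <= hi m.
  apply: le_trans (lo_nd _ _ (leq_maxl n m)) _.
  apply: le_trans (hi_ni _ _ (leq_maxr n m)).
  rewrite /lo /hi; have : 0 <= D * 2 / 2 ^+ (maxn n m).
    by rewrite divr_ge0 ?exprn_ge0//; lra.
  lra.
have lo_sup : has_sup (range lo).
  by split; [exists (lo 0%N), 0%N|exists (hi 0%N) => _ [n _ <-]].
exists (sup (range lo)) => n.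
have : lo n <= sup (range lo) by apply: sup_upper_bound => //; exists n.
have : sup (range lo) <= hi n.
  by apply: ge_sup; [exact: lo_sup.1|move=> _ [m _ <-]].
by rewrite ler_norml /lo /hi; lra.
Qed.

(** Integrating from [a - 1] makes [a] an interior point, hence the primitive is
    differentiable on both sides of [a]. *)
Lemma continuous_primitive a (g : R -> R) : continuous g ->
  exists G : R -> R, G a = 0 /\ forall x, a <= x -> is_derive x 1 G (g x).
Proof.
move=> cg.
pose F x := \int[lebesgue_measure]_(t in `[a - 1, x]) g t.
exists (fun x => F x - F a); split; first by rewrite subrr.
move=> x ax.
have ig : (@lebesgue_measure R).-integrable `[a - 1, x + 1] (EFin \o g).
  apply: continuous_compact_integrable; first exact: segment_compact.
  exact: continuous_subspaceT.
have [] := continuous_FTC1_closed _ ig _ (cg x).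
- by rewrite ltrDl.
- by lra.
rewrite derive1E => dF FE; have := DeriveDef dF FE => Fd.
by apply: is_derive_eq; rewrite subr0.
Qed.

(** Picard iteration.  The weight [exp (2 M (x - a))] makes the integral operator
    a contraction of ratio [1 / 2] on all of [[a, b]], so the interval does not
    have to be subdivided.  Each iterate is fed back through [clamp], because the
    bounds hold only on [[a, b]]. *)
Lemma picard a b (f : R -> R -> R) (M : R) : a <= b -> 0 <= M ->
  (forall x y z, `|f x y - f x z| <= M * `|y - z|) ->
  (forall y : R -> R, continuous y -> continuous (fun x => f x (y x))) ->
  exists th : R -> R, th a = 0 /\
    forall x, x \in `[a, b] -> is_derive x 1 th (f x (th x)).
Proof.
move=> ab M0 flip fcont.
have /choice[prim primP] : forall g : R -> R, exists G : R -> R, continuous g ->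
    G a = 0 /\ forall x, a <= x -> is_derive x 1 G (g x).
  move=> g; have [cg|ncg] := pselect (continuous g); last by exists g.
  by have [G ?] := continuous_primitive a cg; exists G.
pose step (y : R -> R) := prim (fun t => f t (y (clamp a b t))).
have step_props y : {within `[a, b], continuous y} -> step y a = 0 /\
    forall x, x \in `[a, b] -> is_derive x 1 (step y) (f x (y x)).
  move=> cy; have [] := primP (fun t => f t (y (clamp a b t))).
    by apply: fcont; exact: continuous_comp_clamp.
  move=> y0 yd; split => // x xab; have := yd x; rewrite /= clamp_id//; apply.
  by rewrite (itvP xab).
have [th [th_cont th0 thd]] : exists th : nat -> R -> R,
    [/\ forall n, {within `[a, b], continuous (th n)}, forall n, th n a = 0 &
    forall n x, x \in `[a, b] -> is_derive x 1 (th n.+1) (f x (th n x))].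
  pose th n := iter n step (cst 0).
  have th_cont n : {within `[a, b], continuous (th n)}.
    elim: n => [|n ih].
      by apply: continuous_subspaceT => ?; exact: cvg_cst.
    exact: (is_derive_within_continuous (step_props _ ih).2).
  exists th; split => // [n|n x].
    by case: n => [//|n]; exact: (step_props _ (th_cont n)).1.
  exact: (step_props _ (th_cont n)).2.
have subab x t : x \in `[a, b] -> t \in `[a, x] -> t \in `[a, b].
  by rewrite !in_itv/= => /andP[_ xb] /andP[-> /le_trans->].
have [C C0 th1C] : exists2 C : R, 0 <= C &
    forall x, x \in `[a, b] -> `|th 1%N x - th 0%N x| <= C.
  have cN : {within `[a, b], continuous (fun x => `|th 1%N x - th 0%N x|)}.
    by move=> x; apply: cvg_norm; apply: cvgB; exact: th_cont.
  have [c _ cP] := EVT_max ab cN.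
  by exists `|th 1%N c - th 0%N c|.
pose E (x : R) : R := expR (M * 2 * (x - a)).
have Ed x : is_derive x 1 E (M * 2 * E x).
  by rewrite /E; apply: is_derive_eq; rewrite /GRing.scale/=; ring.
have E1 x : a <= x -> 1 <= E x.
  by move=> ax; rewrite /E -expR0 ler_expR !mulr_ge0// subr_ge0.
have dthE n x : x \in `[a, b] -> `|th n.+1 x - th n x| <= C / 2 ^+ n * E x.
  elim: n x => [|n ih] x xab; have ax : a <= x by rewrite (itvP xab).
    rewrite expr0 divr1 (le_trans (th1C _ xab))//.
    by rewrite ler_peMr// E1.
  pose u (t : R) : R := th n.+2 t - th n.+1 t; pose v (t : R) : R := C / 2 ^+ n.+1 * E t.
  pose du (t : R) : R := f t (th n.+1 t) - f t (th n t).
  pose dv (t : R) : R := M * (C / 2 ^+ n * E t).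
  suff : - v x <= u x <= v x by rewrite -ler_norml.
  notypeclasses refine (@derive_dominated _ a x u v du dv ax _ _ _ _) => [t|t|t|].
  - by move/(subab _ _ xab) => tab; apply: is_deriveB; exact: thd.
  - move=> tax; rewrite /v; apply: is_derive_eq.
    rewrite /GRing.scale/= /dv exprS.
    by field; rewrite expf_neq0.
  - move/(subab _ _ xab) => tab; rewrite -ler_norml.
    by apply: le_trans (flip _ _ _) _; rewrite ler_wpM2l//; exact: ih.
  - rewrite -ler_norml /u /v !th0 subrr normr0 mulr_ge0 ?divr_ge0 ?exprn_ge0//.
    by rewrite (le_trans ler01)// E1.
pose D : R := C * E b.
have D0 : 0 <= D by rewrite mulr_ge0// (le_trans ler01)// E1.
have dthD n x : x \in `[a, b] -> `|th n.+1 x - th n x| <= D / 2 ^+ n.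
  move=> xab; apply: le_trans (dthE _ _ xab) _.
  rewrite /D mulrAC ler_wpM2r ?invr_ge0 ?exprn_ge0// ler_wpM2l//.
  rewrite /E ler_expR ler_wpM2l ?mulr_ge0//.
  by move: xab; rewrite in_itv/= => /andP[]; lra.
have /choice[Y YP] x :
    exists l, forall n, `|th n (clamp a b x) - l| <= D * 2 / 2 ^+ n.
  apply: (@dyadic_cauchy_limit (fun n => th n (clamp a b x))) => // n.
  by apply: dthD; exact: clamp_itv.
have D2 : 0 <= D * 2 by lra.
have Y_cont : continuous Y.
  move=> x; apply/cvgrPdist_lt => e e0.
  have [n nP] : exists n, D * 2 / 2 ^+ n < e / 3.
    by apply: exists_half_pow_lt => //; lra.
  have /(_ x) := continuous_comp_clamp ab (th_cont n).
  move=> /cvgrPdist_lt /(_ (e / 3)) near_x.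
  have {}near_x := near_x ltac:(lra).
  apply: filterS near_x => y /=.
  have := YP x n; have := YP y n; move: nP; rewrite !ltr_norml !ler_norml.
  lra.
have [Th0 Thd] := primP (fun t => f t (Y t)) (fcont _ Y_cont).
set Th := prim _ in Th0 Thd.
have ThY x : x \in `[a, b] -> Th x = Y x.
  move=> xab; have ax : a <= x by rewrite (itvP xab).
  apply/eqP; rewrite -subr_eq0 -normr_le0; apply/ler_addgt0Pr => e e0; rewrite add0r.
  have MD0 : 0 <= M * (D * 2) * (x - a).
    by rewrite mulr_ge0 ?subr_ge0// mulr_ge0.
  have [n nP] := exists_half_pow_lt (addr_ge0 MD0 D2) e0.
  have h1 : `|th n.+1 x - Th x| <= M * (D * 2 / 2 ^+ n) * (x - a).
    pose u (t : R) : R := th n.+1 t - Th t; pose v (t : R) : R := M * (D * 2 / 2 ^+ n) * (t - a).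
    pose du (t : R) : R := f t (th n t) - f t (Y t); pose dv (_ : R) : R := M * (D * 2 / 2 ^+ n).
    suff : - v x <= u x <= v x by rewrite -ler_norml.
  notypeclasses refine (@derive_dominated _ a x u v du dv ax _ _ _ _) => [t|t|t|].
    - move=> tax; have tab := subab _ _ xab tax.
      by apply: is_deriveB; [exact: thd|apply: Thd; rewrite (itvP tax)].
    - move=> tax; rewrite /v; apply: is_derive_eq.
      by rewrite /GRing.scale/= /dv; ring.
    - move/(subab _ _ xab) => tab; rewrite -ler_norml.
      apply: le_trans (flip _ _ _) _; rewrite ler_wpM2l//.
      by have := YP t n; rewrite clamp_id.
    - by rewrite -ler_norml /u /v th0 Th0 !subrr mulr0 normr0.
  have h2 : `|th n.+1 x - Y x| <= D * 2 / 2 ^+ n.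
    rewrite -{1}(clamp_id xab); apply: le_trans (YP _ _) _.
    by rewrite ler_wpM2l// lef_pV2 ?posrE ?exprn_gt0// exprS ler_peMl ?exprn_ge0//; lra.
  have MDE : M * (D * 2) * (x - a) / 2 ^+ n = M * (D * 2 / 2 ^+ n) * (x - a).
    by field; rewrite expf_neq0.
  by move: nP h1 h2; rewrite mulrDl MDE !ler_norml; lra.
exists Th; split => // x xab; rewrite ThY//; apply: Thd.
by rewrite (itvP xab).
Qed.

End Picard.

(** * The Pruefer angle *)

Section Trigonometry.
Context {R : realType}.
Implicit Types x y z : R.

Lemma sin_sqr_lipschitz y z : `|sin y ^+ 2 - sin z ^+ 2| <= 2 * `|y - z|.
Proof.
wlog zy : y z / z <= y.
  move=> H; have [zy|/ltW zy] := leP z y; first exact: H.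
  by rewrite distrC (distrC y); exact: H.
rewrite (@ger0_norm _ (y - z)) ?subr_ge0//.
pose u (t : R) : R := sin t ^+ 2 - sin z ^+ 2.
pose v (t : R) : R := 2 * (t - z).
pose du (t : R) : R := 2 * (sin t * cos t); pose dv (t : R) : R := 2.
suff : - v y <= u y <= v y by rewrite -ler_norml.
notypeclasses refine (@derive_dominated _ z y u v du dv zy _ _ _ _) => [t _|t _|t _|].
- by rewrite /u; apply: is_derive_eq; rewrite /GRing.scale/= /du; ring.
- by rewrite /v; apply: is_derive_eq; rewrite /GRing.scale/= /dv; ring.
- have := cos2Dsin2 t; rewrite /du /dv.
  by move: (cos t) (sin t) => C S CS; apply/andP; split; nra.
- by rewrite /u /v !subrr mulr0 oppr0 lexx.
Qed.

(** For [s > 0] this is the continuous branch of [y |-> arctan (s tan y)] that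
    fixes the multiples of [pi / 2]. If [th' >= P (cos^2 th + s^2 sin^2 th)], then
    [stretch s th] increases at speed at least [s P]: it linearizes the fast
    rotation of the angle where the coefficient of [sin^2] is large. *)
Definition stretch (s y : R) : R :=
  y + atan ((s - 1) * (sin y * cos y) / (cos y ^+ 2 + s * sin y ^+ 2)).

Lemma is_derive_stretch s y : 0 < s ->
  is_derive y 1 (stretch s) (s / (cos y ^+ 2 + s ^+ 2 * sin y ^+ 2)).
Proof.
move=> s0; have CS := cos2Dsin2 y.
have D0 : 0 < cos y ^+ 2 + s * sin y ^+ 2.
  by move: CS; move: (cos y) (sin y) => C S; nra.
have D1 : 0 < cos y ^+ 2 + s ^+ 2 * sin y ^+ 2.
  have s20 : 0 < s ^+ 2 by rewrite exprn_gt0.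
  by move: CS; move: (cos y) (sin y) => C S; nra.
pose N (t : R) : R := (s - 1) * (sin t * cos t).
pose D (t : R) : R := cos t ^+ 2 + s * sin t ^+ 2.
have Dy0 : D y != 0 by rewrite gt_eqF.
have Nd : is_derive y 1 N ((s - 1) * (cos y ^+ 2 - sin y ^+ 2)).
  by apply: is_derive_eq; rewrite /GRing.scale/=; ring.
have Dd : is_derive y 1 D (2 * (s - 1) * (sin y * cos y)).
  by apply: is_derive_eq; rewrite /GRing.scale/=; ring.
have NDd : is_derive y 1 (fun t => N t * (D t)^-1) (((s - 1) * (cos y ^+ 2 - sin y ^+ 2) * D y
    - N y * (2 * (s - 1) * (sin y * cos y))) / D y ^+ 2).
  apply: (is_derive_eq (is_deriveM Nd (is_deriveV Dy0 Dd))).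
  by rewrite /GRing.scale/=; field.
have atd := @is_derive1_comp _ atan (fun t => N t * (D t)^-1) y _ _
  (is_derive1_atan (N y / D y)) NDd.
have := is_deriveD (is_derive_id y 1) atd.
move=> H; apply: (is_derive_eq H).
have DN : D y ^+ 2 + N y ^+ 2 = cos y ^+ 2 + s ^+ 2 * sin y ^+ 2.
  transitivity ((cos y ^+ 2 + sin y ^+ 2) * (cos y ^+ 2 + s ^+ 2 * sin y ^+ 2)).
    by rewrite /D /N; ring.
  by rewrite CS mul1r.
have -> : (1 + (N y / D y) ^+ 2)^-1 = D y ^+ 2 / (cos y ^+ 2 + s ^+ 2 * sin y ^+ 2).
  by rewrite -DN; field; rewrite Dy0/= DN gt_eqF.
have -> : (s - 1) * (cos y ^+ 2 - sin y ^+ 2) * D y -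
    N y * (2 * (s - 1) * (sin y * cos y)) =
    (s - 1) * (cos y ^+ 2 - s * sin y ^+ 2).
  transitivity ((cos y ^+ 2 + sin y ^+ 2) *
      ((s - 1) * (cos y ^+ 2 - s * sin y ^+ 2))).
    by rewrite /D /N; ring.
  by rewrite CS mul1r.
transitivity ((cos y ^+ 2 + sin y ^+ 2) * s /
    (cos y ^+ 2 + s ^+ 2 * sin y ^+ 2)); last by rewrite CS mul1r.
by field; rewrite exprMn Dy0 gt_eqF.
Qed.

Lemma stretch_bound s y : `|stretch s y - y| < pi / 2.
Proof.
by rewrite /stretch addrC addKr ltr_norml atan_gtNpi2 atan_ltpi2.
Qed.

End Trigonometry.

Section PruferAngle.
Context {R : realType}.
Variables (a b : R) (p w z : R -> R) (B : R).
Hypotheses (ab : a < b) (p_cont : continuous p) (w_cont : continuous w)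
  (z_cont : continuous z).
Hypotheses (p_bound : forall x, 0 <= p x <= B) (w_bound : forall x, `|w x| <= B)
  (z_bound : forall x, 0 <= z x <= B).

Definition prufer_field (mu x y : R) : R :=
  p x * cos y ^+ 2 + (mu * w x - z x) * sin y ^+ 2.

Definition prufer_angle (mu : R) (th : R -> R) : Prop :=
  th a = 0 /\
  forall x, x \in `[a, b] -> is_derive x 1 th (prufer_field mu x (th x)).

Let B_ge0 : 0 <= B.
Proof. by have /andP[] := p_bound 0; exact: le_trans. Qed.

Lemma prufer_field_lipschitz mu x y y' :
  `|prufer_field mu x y - prufer_field mu x y'| <=
  (`|mu| * B + B *+ 2) * 2 * `|y - y'|.
Proof.
have -> : prufer_field mu x y - prufer_field mu x y' =
    (mu * w x - z x - p x) * (sin y ^+ 2 - sin y' ^+ 2).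
  by rewrite /prufer_field !cos2sin2; ring.
rewrite normrM -[leRHS]mulrA; apply: ler_pM => //; last exact: sin_sqr_lipschitz.
have := p_bound x; have := z_bound x => /andP[z0 zB] /andP[p0 pB].
have : `|mu * w x| <= `|mu| * B by rewrite normrM ler_wpM2l.
by rewrite !ler_norml; move: (mu * w x) (`|mu| * B) => A A'; lra.
Qed.

Lemma prufer_angle_exists mu : exists th, prufer_angle mu th.
Proof.
apply: (@picard _ a b (prufer_field mu) ((`|mu| * B + B *+ 2) * 2)) => //.
- exact: ltW.
- by rewrite mulr_ge0// addr_ge0 ?mulr_ge0// mulrn_wge0.
- exact: prufer_field_lipschitz.
- move=> y cy x; rewrite /prufer_field.
  have cc : {for x, continuous (cos \o y)}.
    by apply: continuous_comp; [exact: cy|exact: continuous_cos].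
  have cs : {for x, continuous (sin \o y)}.
    by apply: continuous_comp; [exact: cy|exact: continuous_sin].
  apply: cvgD; apply: cvgM.
  - exact: p_cont.
  - exact: (cvgM cc cc).
  - by apply: cvgB; [apply: cvgM; [exact: cvg_cst|exact: w_cont]|exact: z_cont].
  - exact: (cvgM cs cs).
Qed.

(** Changing [mu] to [nu] perturbs the field by at most [B |mu - nu|], while the
    Lipschitz constant may be taken at the fixed parameter [nu]; Gronwall's
    inequality then gives a Lipschitz bound at [nu]. *)
Lemma prufer_angle_continuous (th : R -> R -> R) :
  (forall mu, prufer_angle mu (th mu)) -> continuous (th ^~ b).
Proof.
move=> thP nu.
pose M : R := (`|nu| * B + B *+ 2) * 2.
have M0 : 0 <= M by rewrite mulr_ge0// addr_ge0 ?mulr_ge0// mulrn_wge0.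
pose C : R := B * ((b - a + 1) * expR ((M *+ 2 + 1) * (b - a))).
have C0 : 0 <= C.
  by rewrite mulr_ge0// mulr_ge0 ?expR_ge0// addr_ge0// subr_ge0 ltW.
have lip mu : `|th mu b - th nu b| <= C * `|mu - nu|.
  rewrite mulrAC [leRHS](_ : _ = `|mu - nu| * B *
    ((b - a + 1) * expR ((M *+ 2 + 1) * (b - a)))); last by rewrite /C; ring.
  pose u (x : R) : R := th mu x - th nu x.
  pose du (x : R) : R :=
    prufer_field mu x (th mu x) - prufer_field nu x (th nu x).
  apply: (@gronwall _ a b u du M (`|mu - nu| * B) (ltW ab) M0).
  - by rewrite mulr_ge0.
  - by move=> x xab; apply: is_deriveB; [exact: (thP mu).2|exact: (thP nu).2].
  - move=> x xab.
    have -> : du x = (prufer_field nu x (th mu x) - prufer_field nu x (th nu x))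
        + (mu - nu) * (w x * sin (th mu x) ^+ 2).
      by rewrite /du /prufer_field; ring.
    apply: le_trans (ler_normD _ _) _; apply: lerD.
      exact: prufer_field_lipschitz.
    rewrite normrM ler_wpM2l// normrM -[leRHS]mulr1 ler_pM//.
    by rewrite ger0_norm ?sqr_ge0// sin2cos2 gerBl sqr_ge0.
  - by rewrite /u (thP mu).1 (thP nu).1 subrr.
apply/cvgrPdist_lt => e e0.
have C1 : 0 < C + 1 by lra.
have e1 : 0 < e / (C + 1) by rewrite divr_gt0.
apply: filterS (nbhsx_ballx nu _ e1) => mu; rewrite /ball/= distrC => numu.
rewrite distrC (le_lt_trans (lip mu))//.
move: numu; rewrite ltr_pdivlMr//; apply: le_lt_trans.
by rewrite mulrC ler_wpM2l// lerDl.
Qed.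

(** Since [p >= 0] and [mu w >= 0], the field is at least [- z], whatever the size
    of [mu]. *)
Lemma prufer_angle_lower_bound mu th c d : a <= c -> c <= d -> d <= b ->
  0 <= mu -> (forall x, x \in `]a, b[ -> 0 <= w x) -> prufer_angle mu th ->
  - (B * (d - c)) <= th d - th c.
Proof.
move=> ac cd db mu0 w0 [_ thd].
pose u (x : R) : R := th x + B * x.
pose du (x : R) : R := prufer_field mu x (th x) + B.
suff : u c <= u d by rewrite /u; lra.
notypeclasses refine (@derive_ge0_le _ c d u du cd _ _) => x xcd.
  have /thd thx : x \in `[a, b].
    by rewrite in_itv/= (le_trans ac) ?(le_trans _ db) ?(itvP xcd).
  by rewrite /u; apply: is_derive_eq; rewrite /GRing.scale/= /du; ring.
have wx : 0 <= mu * w x.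
  by rewrite mulr_ge0// w0// in_itv/= (le_lt_trans ac) ?(lt_le_trans _ db) ?(itvP xcd).
have /andP[z0 zB] := z_bound x; have /andP[p0 pB] := p_bound x.
rewrite /du /prufer_field; have := cos2Dsin2 (th x).
have := sqr_ge0 (cos (th x)); have := sqr_ge0 (sin (th x)).
by move: (cos _ ^+ 2) (sin _ ^+ 2) (mu * w x) wx => C S W W0 S0 C0 CS; nra.
Qed.

(** [stretch s] moves points by less than [pi / 2], which accounts for the loss of
    [pi]. *)
Lemma prufer_angle_stretch mu th c d s P : a <= c -> c <= d -> d <= b ->
  0 < s -> (forall x, x \in `[c, d] -> P <= p x) ->
  (forall x, x \in `[c, d] -> P * s ^+ 2 <= mu * w x - z x) ->
  prufer_angle mu th ->
  s * P * (d - c) - pi <= th d - th c.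
Proof.
move=> ac cd db s0 Pp Pq [_ thd].
have := stretch_bound s (th d); have := stretch_bound s (th c).
rewrite !ltr_norml => bc bd.
pose E (y : R) : R := cos y ^+ 2 + s ^+ 2 * sin y ^+ 2.
pose u (x : R) : R := stretch s (th x) - s * P * x.
pose du (x : R) : R := s / E (th x) * prufer_field mu x (th x) - s * P.
suff : u c <= u d by rewrite /u; lra.
notypeclasses refine (@derive_ge0_le _ c d u du cd _ _) => x xcd.
  have thx : is_derive x 1 th (prufer_field mu x (th x)).
    apply: thd; move: xcd; rewrite !in_itv/= => /andP[cx xd].
    by rewrite (le_trans ac) ?(le_trans xd).
  have := is_derive1_comp (is_derive_stretch (th x) s0) thx => H.
  have := is_derive_eq (is_deriveB H (is_deriveZ (s * P) (is_derive_id x 1))).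
  by apply; rewrite /GRing.scale/= /du /E; ring.
have := subset_itv_oo_cc xcd => {}xcd.
have E0 : 0 < E (th x).
  have s20 : 0 < s ^+ 2 by rewrite exprn_gt0.
  by rewrite /E; have := cos2Dsin2 (th x); move: (cos _) (sin _) => C S; nra.
rewrite /du; have -> : s * P = s / E (th x) * (P * E (th x)) by field; rewrite gt_eqF.
rewrite subr_ge0 ler_wpM2l ?divr_ge0 ?(ltW s0) ?(ltW E0)//.
rewrite /E /prufer_field mulrDr mulrA.
by apply: lerD; rewrite ler_wpM2r ?sqr_ge0// ?Pp// Pq.
Qed.

(** Only the behaviour on [[c, d]] produces the growth: there [mu w - z] is at least
    [P s ^ 2] once [mu >= (P s ^ 2 + B) / m], for any prescribed [s]. *)
Lemma prufer_angle_unbounded (th : R -> R -> R) c d m P :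
  (forall mu, prufer_angle mu (th mu)) ->
  a <= c -> c < d -> d <= b ->
  (forall x, x \in `]a, b[ -> 0 <= w x) ->
  0 < m -> (forall x, x \in `[c, d] -> m <= w x) ->
  0 < P -> (forall x, P <= p x) ->
  forall A, exists2 mu0, 0 <= mu0 & forall mu, mu0 <= mu -> A <= th mu b.
Proof.
move=> thP ac cd db w0 m0 mw P0 Pp A.
have dc : 0 < d - c by lra.
(* makes [s * P * (d - c)] absorb the two losses [pi] and [B * (b - a)] *)
pose s : R := `|A + pi + B * (b - a)| / (P * (d - c)) + 1.
have s0 : 0 < s by rewrite ltr_wpDl// divr_ge0// mulr_ge0// ltW.
exists ((P * s ^+ 2 + B) / m).
  by rewrite divr_ge0 ?(ltW m0)// addr_ge0// mulr_ge0 ?(ltW P0) ?sqr_ge0.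
move=> mu; rewrite ler_pdivrMr// => mumu.
have mu0 : 0 <= mu.
  rewrite -(pmulr_lge0 _ m0); apply: le_trans mumu.
  by rewrite addr_ge0// mulr_ge0 ?(ltW P0) ?sqr_ge0.
have h1 := prufer_angle_lower_bound (lexx a) ac (le_trans (ltW cd) db) mu0 w0 (thP mu).
have h3 := prufer_angle_lower_bound (le_trans ac (ltW cd)) db (lexx b) mu0 w0 (thP mu).
have h2 : s * P * (d - c) - pi <= th mu d - th mu c.
  apply: (prufer_angle_stretch (mu := mu) (th := th mu) ac (ltW cd) db s0) => //.
  move=> x xcd; have /andP[z0 zB] := z_bound x.
  have : mu * m <= mu * w x by rewrite ler_wpM2l// mw.
  by move: mumu; move: (P * s ^+ 2) (mu * m) (mu * w x) => X Y Z; lra.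
have sA : A + pi + B * (b - a) <= s * P * (d - c).
  apply: le_trans (ler_norm _) _.
  have Pdc : 0 < P * (d - c) by rewrite mulr_gt0.
  rewrite -mulrA -ler_pdivrMr// /s.
  lra.
rewrite (thP mu).1 in h1.
have : 0 <= B * (d - c) by rewrite mulr_ge0// ltW.
move: h1 h2 h3 sA; move: (s * P * (d - c)) => X; lra.
Qed.

End PruferAngle.

(** * Weak derivatives of classically differentiable functions *)

Section WeakDerivative.
Context {R : realType}.
Variables a b : R.
Hypothesis ab : a < b.
Implicit Types u v U V : R -> R.

Local Notation mu := (@lebesgue_measure R).

Lemma weak_derivative_eq (A : set R) u v U V : open A ->
  (forall x, A x -> u x = U x) -> (forall x, A x -> v x = V x) ->
  weak_derivative A U V -> weak_derivative A u v.
Proof.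
move=> oA uU vV [liU liV UV].
have li f F : (forall x, A x -> f x = F x) -> locally_integrable A F ->
    locally_integrable A f.
  move=> fF [mF oF lF]; split => //.
    by apply: eq_measurable_fun mF => x; rewrite inE => /fF.
  move=> K KA cK; have := lF K KA cK.
  congr (_ < _)%E; apply: eq_integral => x; rewrite inE => /KA /fF.
  by move=> /= ->.
split; [exact: li liU|exact: li liV|].
move=> psi tpsi; have := UV psi tpsi.
congr (_ = - _); rewrite /Rintegral; congr fine; apply: eq_integral => x;
  by rewrite inE => Ax; rewrite /= ?uU ?vV.
Qed.

Lemma within_continuous_integrable_oo f : {within `[a, b], continuous f} ->
  mu.-integrable `]a, b[ (EFin \o f).
Proof.
move=> cf.
have : mu.-integrable `[a, b] (EFin \o f).
  by apply: continuous_compact_integrable => //; exact: segment_compact.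
by apply: integrableS => //; exact: subset_itv_oo_cc.
Qed.

Lemma test_function_eq0 (A : set R) psi x : test_function A psi -> ~ A x ->
  psi x = 0.
Proof.
move=> [_ _ sA] Ax; apply/eqP/negPn/negP => px.
by apply: Ax; apply: sA; exact: subset_closure.
Qed.

(** Continuity up to the end points makes [u] and [v] integrable and allows an
    integration by parts over the whole segment, where the boundary terms vanish
    because the support of a test function avoids the end points. *)
Lemma is_derive_weak_derivative u v :
  {within `[a, b], continuous u} -> {within `[a, b], continuous v} ->
  (forall x, x \in `]a, b[ -> is_derive x 1 u (v x)) ->
  weak_derivative `]a, b[ u v.
Proof.
move=> cu cv uv.
have oo : open `]a, b[%classic by exact: interval_open.
split.
- by apply: open_integrable_locally => //; exact: within_continuous_integrable_oo.
- by apply: open_integrable_locally => //; exact: within_continuous_integrable_oo.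
move=> psi tpsi; have [psid _ _] := tpsi.
have cpsi : continuous psi.
  by move=> x; have /derivable1_diffP/differentiable_continuous := psid 0%N x.
have cdpsi : continuous (derive1 psi).
  by move=> x; have /derivable1_diffP/differentiable_continuous := psid 1%N x.
have LR (f : R -> R) : {within `[a, b], continuous f} ->
    (forall x, x \in `]a, b[ -> derivable f x 1) ->
    derivable_oo_LRcontinuous f a b.
  by move=> /(continuous_within_itvP _ ab)[_ fa fb] fd; split.
have psia : psi a = 0.
  by apply: (test_function_eq0 tpsi) => /=; rewrite in_itv/= ltxx.
have psib : psi b = 0.
  by apply: (test_function_eq0 tpsi) => /=; rewrite in_itv/= ltxx andbF.
have psi_LR := LR psi (continuous_subspaceT cpsi) (fun x _ => psid 0%N x).
have u_LR : derivable_oo_LRcontinuous u a b.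
  by apply: LR => // x /uv[].
have u_v : {in `]a, b[, derive1 u =1 v}.
  by move=> x /uv[_ <-]; rewrite derive1E.
have := @Rintegration_by_parts R u psi v (derive1 psi) a b ab cv u_LR u_v
  (continuous_subspaceT cdpsi) psi_LR (fun x _ => erefl).
rewrite psia psib !mulr0 subrr sub0r => parts.
have oo_cc (f : R -> R) : {within `[a, b], continuous f} ->
    \int[mu]_(x in `]a, b[) f x = \int[mu]_(x in `[a, b]) f x.
  move=> cf; rewrite -Rintegral_itv_obnd_cbnd; last first.
    have : mu.-integrable `[a, b] (EFin \o f).
      by apply: continuous_compact_integrable => //; exact: segment_compact.
    by apply: integrableS => //; exact: subset_itv_oc_cc.
  by rewrite Rintegral_itv_bndo_bndc//; exact: within_continuous_integrable_oo.
rewrite !oo_cc ?parts//.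
- move=> x; apply: cvgM; [exact: cv|exact: (continuous_subspaceT cpsi)].
- move=> x; apply: cvgM; [exact: cu|exact: (continuous_subspaceT cdpsi)].
Qed.

(** A bounded function on a set of finite measure. *)
Lemma within_continuous_L2 u : {within `[a, b], continuous u} ->
  L2 `]a, b[ u.
Proof.
move=> cu.
have mA : measurable (`]a, b[%classic : set R) by [].
have mu_ : measurable_fun `]a, b[ u.
  have /integrableP[/measurable_EFinP //] := within_continuous_integrable_oo cu.
have [C C0 uC] : exists2 C : R, 0 <= C & forall x, x \in `[a, b] -> `|u x| <= C.
  have cN : {within `[a, b], continuous (fun x => `|u x|)}.
    by move=> x; apply: cvg_norm; exact: cu.
  have [c _ cP] := EVT_max (ltW ab) cN.
  by exists `|u c|.
rewrite /L2 inE; apply/andP; split.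
  rewrite inE/=; exact/(measurable_restrictT _ _).1.
rewrite inE/= /finite_norm unlock /Lnorm poweR_lty//.
have C2 : (\int[mu]_(x in `]a, b[) (C ^+ 2)%:E < +oo)%E.
  by rewrite integral_cst//= lebesgue_measure_itv/= lte_fin ab -EFinD -EFinM ltry.
apply: le_lt_trans C2.
have mr : measurable_fun [set: R] (u \_ `]a, b[) by exact/(measurable_restrictT _ _).1.
have sqrE x : (`|(EFin \o u \_ `]a, b[) x| `^ 2)%E = ((u \_ `]a, b[) x ^+ 2)%:E.
  by rewrite /= powR_mulrn// real_normK ?num_real.
under eq_integral => x _ do rewrite sqrE.
rewrite [leRHS]integral_mkcond; apply: ge0_le_integral => //.
- by move=> x _; rewrite lee_fin sqr_ge0.
- by apply/measurable_EFinP; exact: measurable_funX.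
- by apply/(measurable_restrictT _ _).1.
- move=> x _; rewrite !patchE; case: ifPn => [|_]; last by rewrite expr0n.
  rewrite inE /= => /subset_itv_oo_cc/uC ux.
  by rewrite lee_fin -[leLHS]real_normK ?num_real// ler_pXn2r ?nnegrE.
Qed.

End WeakDerivative.

(** * Nontriviality and choice of the parameters *)

Section NonTrivial.
Context {R : realType}.

(** By continuity [u] does not vanish on some interval ending at [b], and such an
    interval is not negligible. *)
Lemma not_ae_eq0 (a b : R) (u : R -> R) : a < b ->
  {within `[a, b], continuous u} -> u b != 0 ->
  ~ (u = cst 0 %[ae (@lebesgue_measure R) in `]a, b[%classic]).
Proof.
move=> ab /(continuous_within_itvP _ ab)[_ _ ub] ub0 u0.
have [d d0 du] : exists2 d : R, 0 < d & forall x, b - d < x < b -> u x != 0.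
  move/cvgrPdist_lt : ub => /(_ `|u b|); rewrite normr_gt0 => /(_ ub0).
  move=> [d /= d0 du]; exists d => // x /andP[dx xb].
  have := du x; rewrite /ball_ /= ltr_norml => /(_ _ xb) h.
  apply/eqP => ux; have : `|u b - u x| < `|u b| by apply: h; lra.
  by rewrite ux subr0 ltxx.
pose c : R := Num.max a (b - d).
have cb : c < b by rewrite /c gt_max ab/=; lra.
have neg : (@lebesgue_measure R).-negligible `]c, b[.
  apply: negligibleS u0 => x /=; rewrite in_itv/= => /andP[cx xb] h.
  move: cx; rewrite /c gt_max => /andP[ax dx].
  have /eqP := du x ltac:(by rewrite dx xb); apply.
  by apply: h; rewrite /= in_itv/= ax.
have : lebesgue_measure `]c, b[%classic = 0%E by exact/negligibleP.
rewrite lebesgue_measure_itv/= lte_fin cb -EFinD => /eqP.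
by rewrite eqe subr_eq0 gt_eqF.
Qed.

End NonTrivial.

Section Sequence.
Context {R : realType}.

(** The gap of [1] forces the sequence to be increasing and unbounded at once. *)
Lemma separated_seq (P : R -> Prop) (m : R) :
  (forall A, exists2 x, A <= x & P x) ->
  exists u : nat -> R, [/\ forall j, P (u j), m <= u 0%N &
    forall j, u j + 1 <= u j.+1].
Proof.
move=> HP.
have /choice[f fP] : forall A, exists x, A <= x /\ P x.
  by move=> A; have [x ? ?] := HP A; exists x.
exists (fun j => iter j (fun x => f (x + 1)) (f m)); split.
- by case=> [|j]; exact: (fP _).2.
- exact: (fP _).1.
- by move=> j; exact: (fP _).1.
Qed.

(** The intermediate value theorem between [A] and a point where [G] exceeds some
    multiple of [t] that is above [G A]. *)
Lemma continuous_hits_multiples (G : R -> R) (A t : R) : 0 < t ->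
  continuous G -> (forall B, exists M, forall x, M <= x -> B <= G x) ->
  exists2 x, A <= x & exists n : nat, G x = n%:R * t.
Proof.
move=> t0 cG Ginf.
pose n := Num.bound (`|G A| / t).
have GA : G A <= n%:R * t.
  rewrite -ler_pdivrMr//.
  apply: le_trans (ltW (archi_boundP _)); last by rewrite divr_ge0// ltW.
  by rewrite ler_pM2r ?invr_gt0// ler_norm.
have [M MG] := Ginf (n%:R * t).
have AM : A <= Num.max A M by rewrite le_max lexx.
have GM : n%:R * t <= G (Num.max A M) by apply: MG; rewrite le_max lexx orbT.
have [|x xA Gx] := IVT AM (continuous_subspaceT cG) (v := n%:R * t).
  by rewrite ge_min le_max GA GM orbT.
exists x; first by rewrite (itvP xA).
by exists n.
Qed.

Lemma inv_sqrt_seq (u : nat -> R) : 0 < u 0%N ->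
  (forall j, u j + 1 <= u j.+1) ->
  let l := fun j => (Num.sqrt (u j))^-1 in
  [/\ forall j, 0 < u j, forall j, u 0%N <= u j, decreasing_seq l & l @ \oo --> 0].
Proof.
move=> u0 uS /=.
have uj j : u 0%N + j%:R <= u j.
  elim: j => [|j ih]; first by rewrite addr0.
  by apply: le_trans (uS j); rewrite -natr1; lra.
have u_gt0 j : 0 < u j by apply: lt_le_trans (uj j); rewrite ltr_wpDr.
have u_ge j : u 0%N <= u j by apply: le_trans (uj j); rewrite lerDl.
split => //.
  apply/decreasing_seqP => j.
  rewrite ltf_pV2 ?posrE ?sqrtr_gt0// ltr_sqrt//.
  by apply: lt_le_trans (uS j); rewrite ltrDl.
apply/cvgrPdist_lt => e e0; near=> j.
rewrite sub0r normrN ger0_norm ?invr_ge0 ?sqrtr_ge0//.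
rewrite invf_plt ?posrE ?sqrtr_gt0//.
have eE : e^-1 = Num.sqrt (e ^- 2).
  by rewrite -exprVn sqrtr_sqr ger0_norm// invr_ge0 ltW.
rewrite eE ltr_sqrt//; apply: lt_le_trans (uj j).
have : e ^- 2 <= j%:R by near: j; exact: nbhs_infty_ger.
by move: u0; lra.
Unshelve. all: by end_near. Qed.

End Sequence.

(** * The eigenvalue problem *)

Section Eigenproblem.
Context {R : realType}.
Variables (g h k : R) (rho0 : R -> R).
Hypotheses (g_gt0 : 0 < g) (h_gt0 : 0 < h) (k_gt0 : 0 < k)
  (rho0_C1 : C1_on (- h) 0 rho0)
  (rho0_incr : forall x y, x \in `[- h, 0] -> y \in `[- h, 0] ->
                 x < y -> rho0 x < rho0 y)
  (rho0_bounds : 0 < rho0 (- h) /\ rho0 (- h) < rho0 0).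

Let drho := derive_within `[- h, 0] rho0.
Let cl := clamp (- h) 0.
Let Nh_lt0 : - h < 0. Proof. by rewrite oppr_lt0. Qed.

Let p (x : R) : R := (rho0 (cl x))^-1.
Let w (x : R) : R := g * k ^+ 2 * drho (cl x).
Let z (x : R) : R := k ^+ 2 * rho0 (cl x).
Let q (mu x : R) : R := mu * w x - z x.

Let rho0_bound x : x \in `[- h, 0] -> rho0 (- h) <= rho0 x <= rho0 0.
Proof.
move=> xh; have hh : - h \in `[- h, 0] by rewrite in_itv/= lexx ltW.
have h0 : 0 \in `[- h, 0] by rewrite in_itv/= lexx ltW.
apply/andP; split.
  have [->//|ne] := eqVneq x (- h); apply/ltW/rho0_incr => //.
  by rewrite lt_neqAle eq_sym ne (itvP xh).
have [->//|ne] := eqVneq x 0; apply/ltW/rho0_incr => //.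
by rewrite lt_neqAle ne (itvP xh).
Qed.

Let rho0_gt0 x : x \in `[- h, 0] -> 0 < rho0 x.
Proof. by move=> /rho0_bound/andP[+ _]; apply: lt_le_trans; case: rho0_bounds. Qed.

Let cl_itv x : cl x \in `[- h, 0].
Proof. by apply: clamp_itv; exact: ltW. Qed.

Let rho0_cont : {within `[- h, 0], continuous rho0}.
Proof. exact: C1_on_continuous. Qed.

Let drho_cont : {within `[- h, 0], continuous drho}.
Proof. by case: rho0_C1. Qed.

Let p_cont : continuous p.
Proof.
move=> x; apply: cvgV; first by rewrite gt_eqF// rho0_gt0.
exact: (continuous_comp_clamp (ltW Nh_lt0) rho0_cont).
Qed.

Let w_cont : continuous w.
Proof.
move=> x; apply: cvgM; first exact: cvg_cst.
exact: (continuous_comp_clamp (ltW Nh_lt0) drho_cont).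
Qed.

Let z_cont : continuous z.
Proof.
move=> x; apply: cvgM; first exact: cvg_cst.
exact: (continuous_comp_clamp (ltW Nh_lt0) rho0_cont).
Qed.

Let q_cont mu : continuous (q mu).
Proof.
move=> x; apply: cvgB; last exact: z_cont.
by apply: cvgM; [exact: cvg_cst|exact: w_cont].
Qed.

(** Undoing the Pruefer substitution, with the amplitude [exp lr].  The value of
    [th 0] gives [cos th = - mu g k^2 rho0(0) sin th] at [0], which is the boundary
    condition, and also [sin th <> 0] there, so the eigenfunction is not zero. *)
Lemma prufer_phase_eigenfunction mu th n : 0 < mu ->
  prufer_angle (- h) 0 p w z mu th ->
  th 0 = pi / 2 + atan (mu * (g * k ^+ 2 * rho0 0)) + n%:R * pi ->
  exists phi, [/\ H2 `]- h, 0[ phi,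
    ~ (phi = cst 0 %[ae lebesgue_measure in `]- h, 0[%classic]) &
    solves_eigenproblem g h k rho0 (Num.sqrt mu)^-1 phi].
Proof.
move=> mu0 [tha thd] th0.
have th_cont : {within `[- h, 0], continuous th}.
  exact: (is_derive_within_continuous thd).
pose tc (x : R) : R := th (cl x).
have tc_cont : continuous tc.
  exact: (continuous_comp_clamp (ltW Nh_lt0) th_cont).
have cs : continuous (sin \o tc).
  by move=> x; apply: continuous_comp; [exact: tc_cont|exact: continuous_sin].
have cc : continuous (cos \o tc).
  by move=> x; apply: continuous_comp; [exact: tc_cont|exact: continuous_cos].
(* [amp] is the logarithmic derivative of the amplitude *)
pose amp (x : R) : R := (p x - q mu x) * (sin (tc x) * cos (tc x)).
have amp_cont : continuous amp.
  move=> x; apply: cvgM; last exact: (cvgM (cs x) (cc x)).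
  by apply: cvgB; [exact: p_cont|exact: q_cont].
have [lr [_ lrd]] := continuous_primitive (- h) amp_cont.
pose phi (x : R) : R := expR (lr x) * sin (th x).
pose psi (x : R) : R := expR (lr x) * cos (th x).
have lrd' x : x \in `[- h, 0] ->
    is_derive x 1 lr ((p x - q mu x) * (sin (th x) * cos (th x))).
  move=> xh; have := lrd x; rewrite /amp /tc /cl clamp_id//; apply.
  by rewrite (itvP xh).
have phid x : x \in `[- h, 0] -> is_derive x 1 phi (p x * psi x).
  move=> xh; have lx := lrd' _ xh; have tx := thd _ xh.
  have e1 := is_derive1_comp (is_derive_expR (lr x)) lx.
  have e2 := is_derive1_comp (is_derive_sin (th x)) tx.
  apply: (is_derive_eq (is_deriveM e1 e2)).
  rewrite /GRing.scale/= /prufer_field /psi -/(q mu x).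
  transitivity (p x * (expR (lr x) * cos (th x)) *
    (cos (th x) ^+ 2 + sin (th x) ^+ 2)); last by rewrite cos2Dsin2 mulr1.
  by ring.
have psid x : x \in `[- h, 0] -> is_derive x 1 psi (- q mu x * phi x).
  move=> xh; have lx := lrd' _ xh; have tx := thd _ xh.
  have e1 := is_derive1_comp (is_derive_expR (lr x)) lx.
  have e2 := is_derive1_comp (is_derive_cos (th x)) tx.
  apply: (is_derive_eq (is_deriveM e1 e2)).
  rewrite /GRing.scale/= /prufer_field /phi -/(q mu x).
  transitivity (- q mu x * (expR (lr x) * sin (th x)) *
    (cos (th x) ^+ 2 + sin (th x) ^+ 2)); last by rewrite cos2Dsin2 mulr1.
  by ring.
have phi_cont := is_derive_within_continuous phid.
have psi_cont := is_derive_within_continuous psid.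
pose dphi (x : R) : R := (rho0 x)^-1 * psi x.
pose ddphi (x : R) : R := (rho0 x)^-1 * (- q mu x * phi x)
  - (rho0 x)^-1 * (rho0 x)^-1 * drho x * psi x.
pose dflux (x : R) : R := - q mu x * phi x.
have pE x : x \in `[- h, 0] -> p x = (rho0 x)^-1.
  by move=> xh; rewrite /p /cl clamp_id.
have inv_cont : {within `[- h, 0], continuous (fun x => (rho0 x)^-1)}.
  apply/subspace_continuousP => x xh; apply: cvgV.
    by rewrite gt_eqF// rho0_gt0.
  by move/subspace_continuousP : rho0_cont; exact.
have dphi_cont : {within `[- h, 0], continuous dphi}.
  by move=> x; apply: cvgM; [exact: inv_cont|exact: psi_cont].
have dflux_cont : {within `[- h, 0], continuous dflux}.
  move=> x; apply: cvgM; last exact: phi_cont.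
  have qc : {within `[- h, 0], continuous (q mu)}.
    by apply: continuous_subspaceT => y; exact: q_cont.
  by apply: cvgN; exact: qc.
have ddphi_cont : {within `[- h, 0], continuous ddphi}.
  move=> x; apply: cvgB.
    by apply: cvgM; [exact: inv_cont|exact: dflux_cont].
  apply: cvgM; last exact: psi_cont.
  apply: cvgM; last exact: drho_cont.
  by apply: cvgM; exact: inv_cont.
have dphiW : weak_derivative `]- h, 0[ phi dphi.
  notypeclasses refine (is_derive_weak_derivative Nh_lt0 phi_cont dphi_cont _).
  by move=> x /subset_itv_oo_cc xh; rewrite /dphi -pE//; exact: phid.
have ddphiW : weak_derivative `]- h, 0[ dphi ddphi.
  notypeclasses refine (is_derive_weak_derivative Nh_lt0 dphi_cont ddphi_cont _).
  move=> x xoo.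
  have xh := subset_itv_oo_cc xoo.
  have rd := C1_on_is_derive rho0_C1 xoo.
  have rn0 : rho0 x != 0 by rewrite gt_eqF// rho0_gt0.
  apply: (is_derive_eq (is_deriveM (is_deriveV rn0 rd) (psid _ xh))).
  by rewrite /GRing.scale/= /ddphi /drho expr2 invfM; ring.
have [r0 s0] : cos (th 0) = - (mu * (g * k ^+ 2 * rho0 0)) * sin (th 0) /\
    sin (th 0) != 0.
  rewrite th0 mulr_natl (alternatingn (@sinDpi R)) (alternatingn (@cosDpi R)).
  set T := mu * _; rewrite addrC sinDpihalf cosDpihalf.
  have cT : cos (atan T) != 0.
    by rewrite gt_eqF// cos_gt0_pihalf// atan_gtNpi2 atan_ltpi2.
  have sT : sin (atan T) = T * cos (atan T).
    by have := atanK T; rewrite /tan => /(canRL (divfK cT)).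
  by split; [rewrite sT; ring|rewrite mulf_neq0// signr_eq0].
exists phi; split.
- exists dphi, ddphi; split; by [|exact: within_continuous_L2].
- by apply: not_ae_eq0 => //; rewrite /phi mulf_neq0// gt_eqF// expR_gt0.
have lam2 : (Num.sqrt mu)^-1 ^+ 2 = mu^-1.
  by rewrite exprVn sqr_sqrtr// ltW.
exists dphi, dflux, phi, dphi; split.
- exact: dphiW.
- apply: (@weak_derivative_eq _ _ _ _ psi dflux) => //.
  + move=> x /= /subset_itv_oo_cc xh.
    by rewrite /dphi mulrA divff ?mul1r// gt_eqF// rho0_gt0.
  + notypeclasses refine (is_derive_weak_derivative Nh_lt0 psi_cont dflux_cont _).
    by move=> x /subset_itv_oo_cc; exact: psid.
- apply: aeW => x /subset_itv_oo_cc xh; rewrite lam2 /dflux /q /w /z /cl clamp_id//.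
  by rewrite /drho; field; rewrite gt_eqF.
- by split; (split; [|exact: ae_eq_refl]).
- split; last by rewrite /phi tha sin0 mulr0.
  have r00 : rho0 0 != 0 by rewrite gt_eqF// rho0_gt0// in_itv/= lexx ltW.
  rewrite lam2 /dphi /psi /phi r0; field.
  by rewrite r00 gt_eqF.
Qed.

Let drho_bounded : exists2 C : R, 0 <= C &
  forall x, x \in `[- h, 0] -> `|drho x| <= C.
Proof.
have cN : {within `[- h, 0], continuous (fun x => `|drho x|)}.
  by move=> x; apply: cvg_norm; exact: drho_cont.
have [c _ cP] := EVT_max (ltW Nh_lt0) cN.
by exists `|drho c|.
Qed.

(** The last term of [G] is bounded by [pi / 2], so [G] inherits the growth of the
    angle. *)
Lemma large_eigenparameter A : exists2 mu, A <= mu &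
  exists phi, [/\ H2 `]- h, 0[ phi,
    ~ (phi = cst 0 %[ae lebesgue_measure in `]- h, 0[%classic]) &
    solves_eigenproblem g h k rho0 (Num.sqrt mu)^-1 phi].
Proof.
have [rhom_gt0 rhomp] := rho0_bounds.
have rhop_gt0 : 0 < rho0 0 by exact: lt_trans rhomp.
have gk_gt0 : 0 < g * k ^+ 2 by rewrite mulr_gt0// exprn_gt0.
have [C C0 drhoC] := drho_bounded.
pose B : R := (rho0 (- h))^-1 + g * k ^+ 2 * C + k ^+ 2 * rho0 0.
have [B1 B2 B3] : [/\ 0 <= (rho0 (- h))^-1, 0 <= g * k ^+ 2 * C &
    0 <= k ^+ 2 * rho0 0].
  by rewrite invr_ge0 ltW// mulr_ge0 ?(ltW gk_gt0)// mulr_ge0 ?sqr_ge0 ?(ltW rhop_gt0).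
have p_bound x : 0 <= p x <= B.
  have /andP[r1 r2] := rho0_bound (cl_itv x); have r0 := rho0_gt0 (cl_itv x).
  have : p x <= (rho0 (- h))^-1 by rewrite lef_pV2 ?posrE.
  by rewrite /B invr_ge0 (ltW r0)/=; move: B2 B3; lra.
have w_bound x : `|w x| <= B.
  rewrite normrM (gtr0_norm gk_gt0).
  apply: (@le_trans _ _ (g * k ^+ 2 * C)); last by rewrite /B; lra.
  by rewrite ler_wpM2l ?(ltW gk_gt0)// drhoC.
have z_bound x : 0 <= z x <= B.
  have /andP[r1 r2] := rho0_bound (cl_itv x); have r0 := rho0_gt0 (cl_itv x).
  have : z x <= k ^+ 2 * rho0 0 by rewrite ler_wpM2l ?sqr_ge0.
  by rewrite mulr_ge0 ?sqr_ge0 ?(ltW r0)//= /B; move: B1 B2; lra.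
have /choice[th thP] : forall mu, exists th, prufer_angle (- h) 0 p w z mu th.
  exact: (prufer_angle_exists Nh_lt0 p_cont w_cont z_cont p_bound w_bound z_bound).
have th_cont := prufer_angle_continuous Nh_lt0 p_bound w_bound z_bound thP.
have w_ge0 x : x \in `]- h, 0[ -> 0 <= w x.
  move=> xoo; rewrite mulr_ge0 ?(ltW gk_gt0)//.
  rewrite /cl clamp_id ?subset_itv_oo_cc//.
  exact: (C1_increasing_derive_ge0 rho0_C1).
have [c coo drhoc] := C1_increasing_derive_gt0 Nh_lt0 rho0_C1 rho0_incr.
have wc_gt0 : 0 < w c by rewrite /w /cl clamp_id ?subset_itv_oo_cc// mulr_gt0.
have m_gt0 : 0 < w c / 2 by rewrite divr_gt0.
have [d [cd d0 wm]] : exists d, [/\ c < d, d <= 0 &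
    forall x, x \in `[c, d] -> w c / 2 <= w x].
  have /cvgrPdist_lt/(_ _ m_gt0) near_w := @w_cont c.
  have near_c : \forall x \near c, `|w c - w x| < w c / 2 /\ x \in `]- h, 0[.
    by near=> x; split; near: x; [exact: near_w|exact: near_in_itvoo].
  have [e /= e0 be] := (@nbhs_ballP R R c _).1 near_c.
  have de x : x \in `[c, c + e / 2] -> ball c e x.
    by rewrite in_itv/= /ball/= ltr_norml => /andP[]; move: e0; lra.
  exists (c + e / 2); split; first by move: e0; lra.
    have [|_] := be (c + e / 2).
      by apply: de; rewrite in_itv/= lexx; move: e0; lra.
    by rewrite in_itv/= => /andP[_ /ltW].
  by move=> x /de/be[+ _]; rewrite ltr_norml; lra.
have hc : - h <= c by rewrite (itvP coo).
have P_gt0 : 0 < (rho0 0)^-1 by rewrite invr_gt0.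
have Pp x : (rho0 0)^-1 <= p x.
  have /andP[r1 r2] := rho0_bound (cl_itv x); have r0 := rho0_gt0 (cl_itv x).
  by rewrite lef_pV2 ?posrE.
have th_unbounded := prufer_angle_unbounded p_bound z_bound
  thP hc cd d0 w_ge0 m_gt0 wm P_gt0 Pp.
pose G (mu : R) : R := th mu 0 - pi / 2 - atan (mu * (g * k ^+ 2 * rho0 0)).
have atan_cont : continuous (atan \o (fun m : R => m * (g * k ^+ 2 * rho0 0))).
  move=> m; apply: continuous_comp; last exact: continuous_atan.
  by apply: cvgM; [exact: cvg_id|exact: cvg_cst].
have G_cont : continuous G.
  move=> mu; apply: cvgB; last exact: atan_cont.
  by apply: cvgB; [exact: th_cont|exact: cvg_cst].
have G_unbounded D : exists M, forall mu, M <= mu -> D <= G mu.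
  have [M _ thM] := th_unbounded (D + pi); exists M => mu /thM.
  by have := atan_ltpi2 (mu * (g * k ^+ 2 * rho0 0)); rewrite /G; lra.
have [mu Amu [n Gmu]] :=
  continuous_hits_multiples (Num.max A 1) (pi_gt0 R) G_cont G_unbounded.
move: Amu; rewrite ge_max => /andP[Amu mu1].
exists mu => //; apply: (@prufer_phase_eigenfunction mu (th mu) n) => //.
  exact: lt_le_trans mu1.
by rewrite -Gmu /G; ring.
Unshelve. all: by end_near. Qed.

(** The logarithmic derivative of [rho0] is bounded, so that its supremum is a
    genuine least upper bound, and it is positive somewhere. *)
Lemma density_length_gt0 : 0 < density_length h rho0.
Proof.
have [rhom_gt0 _] := rho0_bounds.
have [C C0 drhoC] := drho_bounded.
have [c coo drhoc] := C1_increasing_derive_gt0 Nh_lt0 rho0_C1 rho0_incr.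
have coc := subset_itv_oo_cc coo.
rewrite invr_gt0; apply: (@lt_le_trans _ _ (drho c / rho0 c)).
  by rewrite divr_gt0// rho0_gt0.
apply: sup_upper_bound; last by exists c.
split; first by exists (drho c / rho0 c), c.
exists (C / rho0 (- h)) => _ [x xh <-].
have /andP[r1 _] := rho0_bound xh.
have r0 := rho0_gt0 xh; apply: (@le_trans _ _ (C / rho0 x)).
  by rewrite ler_pM2r ?invr_gt0// (le_trans (ler_norm _))// drhoC.
by rewrite ler_wpM2l// lef_pV2 ?posrE.
Qed.

End Eigenproblem.

Theorem theorem2p1 (R : realType) (g h k : R) (rho0 : R -> R)
    (g_gt0 : 0 < g) (h_gt0 : 0 < h) (k_gt0 : 0 < k)
    (rho0_C1 : C1_on (- h) 0 rho0)
    (rho0_incr : forall x y, x \in `[- h, 0] -> y \in `[- h, 0] ->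
                   x < y -> rho0 x < rho0 y)
    (rho0_bounds : 0 < rho0 (- h) /\ rho0 (- h) < rho0 0) :
  exists (lambda : nat -> R) (phi : nat -> R -> R),
    [/\ forall j, 0 < lambda j /\ lambda j < Num.sqrt (g / density_length h rho0),
        forall j, [/\ H2 `]- h, 0[ (phi j),
                      ~ (phi j = cst 0 %[ae lebesgue_measure in `]- h, 0[%classic]) &
                      solves_eigenproblem g h k rho0 (lambda j) (phi j)],
        decreasing_seq lambda &
        lambda @ \oo --> 0].
Proof.
have L0 := density_length_gt0 h_gt0 rho0_C1 rho0_incr rho0_bounds.
have gL0 : 0 < g / density_length h rho0 by rewrite divr_gt0.
have [u [uP um uS]] := separated_seq ((g / density_length h rho0)^-1 + 1)
  (large_eigenparameter g_gt0 h_gt0 k_gt0 rho0_C1 rho0_incr rho0_bounds).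
have gL_u : (g / density_length h rho0)^-1 < u 0%N.
  by apply: lt_le_trans um; rewrite ltrDl.
have u00 : 0 < u 0%N by apply: lt_trans gL_u; rewrite invr_gt0.
have [u_gt0 u_ge lam_decr lam_cvg] := inv_sqrt_seq u00 uS.
have /choice[phi phiP] := uP.
exists (fun j => (Num.sqrt (u j))^-1), phi; split => // j.
split; first by rewrite invr_gt0 sqrtr_gt0.
rewrite -sqrtrV ?(ltW (u_gt0 j))// ltr_sqrt// invf_plt ?posrE//.
exact: lt_le_trans (u_ge j).
Qed.
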